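(* Consider either the Fokker-Planck scheme with a discrete Maxwellian satisfying (A-FP), or the BGK scheme with a discrete Maxwellian satisfying (A-BGK) (all defined in the context). Fix the meshes, the time step $\Delta t>0$ and initial data $(f_{ij}^0)_{i\in\mathcal I,j\in\mathcal J}\in\mathbb R^{\mathcal I\times\mathcal J}$ (independent of $\varepsilon$). For $\varepsilon>0$ let $f_\varepsilon^n=(f_{ij}^n)_{i\in\mathcal I,j\in\mathcal J}$, $n\in\mathbb N$, be the solution of the scheme with this initial data. Then there is $\rho^n=(\rho_i^n)_{i\in\mathcal I}\in\mathbb R^{\mathcal I}$ for all $n\ge 0$ such that, when $\varepsilon\to0$, $$f_\varepsilon^n\longrightarrow \rho^n\mathcal M=(\rho_i^n\mathcal M_j)_{i\in\mathcal I,j\in\mathcal J}\quad\text{in }\mathbb R^{\mathcal I\times\mathcal J},\quad\text{for all } n\ge1,$$ and the limit satisfies the finite difference scheme for the heat equation $$\Delta x_i\,\frac{\rho_i^{n+1}-\rho_i^n}{\Delta t}=\frac{m_2^{\Delta v}}{2}\left((D_x\rho^{n+1})_{i+1}-(D_x\rho^{n+1})_{i-1}\right),\qquad\forall i\in\mathcal I,\ \forall n\ge0,$$ with initial data $\rho_i^0=\sum_{j\in\mathcal J}\Delta v_j f_{ij}^0$.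
   Context: Velocity mesh. Fix $v_\star>0$ and an integer $L\ge1$. Interfaces $v_{j+1/2}$, $j=-L,\dots,L$, are strictly increasing with $v_{-L+1/2}=-v_\star$, $v_{1/2}=0$, $v_{L+1/2}=v_\star$ and $v_{j+1/2}=-v_{-j+1/2}$ for $j=0,\dots,L$. Let $\mathcal J=\{-L+1,\dots,L\}$; for $j\in\mathcal J$ the cell $(v_{j-1/2},v_{j+1/2})$ has length $\Delta v_j$ and midpoint $v_j$. Let $\mathcal J^*=\{-L,\dots,L\}$, $v_{-L}:=-v_\star$, $v_{L+1}:=v_\star$ and $\Delta v_{j+1/2}=v_{j+1}-v_j$ for $j\in\mathcal J^*$. Space mesh. The torus of length $1$ is divided into $N$ consecutive intervals indexed by $\mathcal I=\mathbb Z/N\mathbb Z$, of lengths $\Delta x_i>0$. For $\rho\in\mathbb R^{\mathcal I}$: $\rho_{i+1/2}=\frac{\rho_i+\rho_{i+1}}2$ and $(D_x\rho)_i=\frac{\rho_{i+1/2}-\rho_{i-1/2}}{\Delta x_i}$. Discrete Maxwellians. Let $0<\underline m_2\le\overline m_2$ and $\overline m_4$ be fixed constants, and $m_k^{\Delta v}=\sum_{j\in\mathcal J}|v_j|^k\mathcal M_j\Delta v_j$. (A-BGK): $(\mathcal M_j)_{j\in\mathcal J}$ satisfies $\mathcal M_j>0$ for all $j\in\mathcal J$, $\mathcal M_j=\mathcal M_{-j+1}$ for $j=1,\dots,L$, $\sum_{j\in\mathcal J}\mathcal M_j\Delta v_j=1$, $\underline m_2\le m_2^{\Delta v}\le\overline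 m_2$, $m_4^{\Delta v}\le\overline m_4$. (A-FP): $(\mathcal M^*_{j+1/2})_{j\in\mathcal J^*}$ satisfies $\mathcal M^*_{j+1/2}=\mathcal M^*_{-j+1/2}$ for $j\in\mathcal J^*$, $\mathcal M^*_{L+1/2}=\mathcal M^*_{-L+1/2}=0$, $\mathcal M_j:=\frac{\mathcal M^*_{j-1/2}-\mathcal M^*_{j+1/2}}{v_j\Delta v_j}>0$ for $j\in\mathcal J$, $\sum_{j\in\mathcal J}\mathcal M_j\Delta v_j=1$, $\underline m_2\le m_2^{\Delta v}\le\overline m_2$, $m_4^{\Delta v}\le\overline m_4$. Schemes ($\varepsilon>0$, $\Delta t>0$). Transport flux: $\mathcal F^{n}_{i+1/2,j}=v_j\frac{f^n_{i+1,j}+f^n_{ij}}2\Delta v_j$. Fokker-Planck scheme: for all $i\in\mathcal I,j\in\mathcal J,n\ge0$, $$\varepsilon\Delta x_i\Delta v_j(f_{ij}^{n+1}-f_{ij}^n)+\Delta t(\mathcal F^{n+1}_{i+1/2,j}-\mathcal F^{n+1}_{i-1/2,j})=\frac{\Delta t}{\varepsilon}(\mathcal G^{n+1}_{i,j+1/2}-\mathcal G^{n+1}_{i,j-1/2}),$$ where $\mathcal G^{n}_{i,j+1/2}=\mathcal M^*_{j+1/2}\left(\frac{f^n_{i,j+1}}{\mathcal M_{j+1}}-\frac{f^n_{ij}}{\mathcal M_j}\right)\frac{\Delta x_i}{\Delta v_{j+1/2}}$ for $j\in\mathcal J^*\setminus\{-L,L\}$ and $\mathcal G^n_{i,-L+1/2}=\mathcal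 G^n_{i,L+1/2}=0$. BGK scheme: for all $i\in\mathcal I,j\in\mathcal J,n\ge0$, $$\varepsilon\Delta x_i\Delta v_j(f_{ij}^{n+1}-f_{ij}^n)+\Delta t(\mathcal F^{n+1}_{i+1/2,j}-\mathcal F^{n+1}_{i-1/2,j})=\frac{\Delta t}{\varepsilon}\Delta x_i\Delta v_j(\rho_i^{n+1}\mathcal M_j-f_{ij}^{n+1}),\quad \rho_i^n=\sum_{j\in\mathcal J}\Delta v_jf_{ij}^n.$$ Each scheme has a unique solution for given initial data. *)

(* Defs.v *)
From HB Require Import structures.
From mathcomp Require Import all_boot all_order all_algebra.
From mathcomp Require Import all_classical all_reals all_analysis.

Set Implicit Arguments.
Unset Strict Implicit.
Unset Printing Implicit Defensive.

Import Order.TTheory GRing.Theory Num.Theory.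
Import numFieldNormedType.Exports.

Local Open Scope classical_set_scope.
Local Open Scope ring_scope.

(* Indices are shifted so as to start at 0.
   - Cells: j in {-L+1, ..., L} is the ordinal j + L - 1 : 'I_L.*2, and rev_ord
     is j |-> -j+1.
   - Interfaces: j+1/2 with j in {-L, ..., L} is the ordinal
     j + L : 'I_L.*2.+1, and rev_ord is j+1/2 |-> -j+1/2.
   - Z/NZ is 'I_N, whose cyclic shifts i+1 and i-1 are ordS i and ord_pred i;
     unlike 'Z_N this is also correct for N = 1. *)

Section Mesh.
Variables (R : realType) (L N : nat).

(* [edgeL j] and [edgeR j] are the interfaces j-1/2 and j+1/2 of the cell j. *)
Definition edgeL (j : 'I_L.*2) : 'I_L.*2.+1 := widen_ord (leqnSn _) j.
Definition edgeR (j : 'I_L.*2) : 'I_L.*2.+1 := lift ord0 j.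

(* [cellL k] and [cellR k] are the cells j and j+1 on both sides of the
   interface k = j+1/2; they are [None] for j = -L and j = L respectively. *)
Definition cellL (k : 'I_L.*2.+1) : option 'I_L.*2 := unlift ord0 k.
Definition cellR (k : 'I_L.*2.+1) : option 'I_L.*2 := unlift ord_max k.

Lemma cellL_edgeR (j : 'I_L.*2) : cellL (edgeR j) = Some j.
Proof. by rewrite /cellL /edgeR liftK. Qed.

Lemma cellR_edgeL (j : 'I_L.*2) : cellR (edgeL j) = Some j.
Proof.
rewrite /cellR (_ : edgeL j = lift ord_max j) ?liftK //.
by apply/val_inj; rewrite [RHS]lift_max.
Qed.

Record velocity_mesh (vstar : R) (vh : 'I_L.*2.+1 -> R) : Prop :=
  VelocityMesh {
    vmesh_incr : forall k l : 'I_L.*2.+1, (k < l)%N -> vh k < vh l;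
    vmesh_first : vh ord0 = - vstar;
    vmesh_mid : vh (inord L) = 0;
    vmesh_last : vh ord_max = vstar;
    vmesh_sym : forall k : 'I_L.*2.+1, (L <= k)%N -> vh k = - vh (rev_ord k) }.

Record space_mesh (dx : 'I_N -> R) : Prop := SpaceMesh {
  smesh_gt0 : forall i, 0 < dx i;
  smesh_sum : \sum_i dx i = 1 }.

Variables (vstar : R) (vh : 'I_L.*2.+1 -> R) (dx : 'I_N -> R).

Definition dv (j : 'I_L.*2) : R := vh (edgeR j) - vh (edgeL j).
Definition vmid (j : 'I_L.*2) : R := (vh (edgeL j) + vh (edgeR j)) / 2.

(* v_{j+1} - v_j, with the conventions v_{-L} = - vstar, v_{L+1} = vstar. *)
Definition dvh (k : 'I_L.*2.+1) : R :=
  oapp vmid vstar (cellR k) - oapp vmid (- vstar) (cellL k).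

Definition rho_half (rho : 'I_N -> R) (i : 'I_N) : R :=
  (rho i + rho (ordS i)) / 2.

Definition Dx (rho : 'I_N -> R) (i : 'I_N) : R :=
  (rho_half rho i - rho_half rho (ord_pred i)) / dx i.

Definition moment (M : 'I_L.*2 -> R) (k : nat) : R :=
  \sum_j `|vmid j| ^+ k * M j * dv j.

Record maxwellian_BGK (m2min m2max m4max : R) (M : 'I_L.*2 -> R) : Prop :=
  MaxwellianBGK {
    bgk_gt0 : forall j, 0 < M j;
    bgk_sym : forall j : 'I_L.*2, (L <= j)%N -> M j = M (rev_ord j);
    bgk_mass : \sum_j M j * dv j = 1;
    bgk_m2 : m2min <= moment M 2 <= m2max;
    bgk_m4 : moment M 4 <= m4max }.

Record maxwellian_FP (m2min m2max m4max : R)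
    (Mstar : 'I_L.*2.+1 -> R) (M : 'I_L.*2 -> R) : Prop :=
  MaxwellianFP {
    fp_sym : forall k, Mstar k = Mstar (rev_ord k);
    fp_last : Mstar ord_max = 0;
    fp_first : Mstar ord0 = 0;
    fp_def : forall j,
      M j = (Mstar (edgeL j) - Mstar (edgeR j)) / (vmid j * dv j);
    fp_gt0 : forall j, 0 < M j;
    fp_mass : \sum_j M j * dv j = 1;
    fp_m2 : m2min <= moment M 2 <= m2max;
    fp_m4 : moment M 4 <= m4max }.

Definition density (f : 'M[R]_(N, L.*2)) (i : 'I_N) : R :=
  \sum_j dv j * f i j.

(* [xflux f i j] is the transport flux through i+1/2. *)
Definition xflux (f : 'M[R]_(N, L.*2)) (i : 'I_N) (j : 'I_L.*2) : R :=
  vmid j * ((f (ordS i) j + f i j) / 2) * dv j.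

Definition vflux (Mstar : 'I_L.*2.+1 -> R) (M : 'I_L.*2 -> R)
    (f : 'M[R]_(N, L.*2)) (i : 'I_N) (k : 'I_L.*2.+1) : R :=
  match cellL k, cellR k with
  | Some jl, Some jr =>
      Mstar k * (f i jr / M jr - f i jl / M jl) * (dx i / dvh k)
  | _, _ => 0
  end.

Definition FP_scheme (Mstar : 'I_L.*2.+1 -> R) (M : 'I_L.*2 -> R)
    (dt eps : R) (f : nat -> 'M[R]_(N, L.*2)) : Prop :=
  forall i j n,
    eps * dx i * dv j * (f n.+1 i j - f n i j)
      + dt * (xflux (f n.+1) i j - xflux (f n.+1) (ord_pred i) j)
    = dt / eps * (vflux Mstar M (f n.+1) i (edgeR j)
                  - vflux Mstar M (f n.+1) i (edgeL j)).

Definition BGK_scheme (M : 'I_L.*2 -> R)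
    (dt eps : R) (f : nat -> 'M[R]_(N, L.*2)) : Prop :=
  forall i j n,
    eps * dx i * dv j * (f n.+1 i j - f n i j)
      + dt * (xflux (f n.+1) i j - xflux (f n.+1) (ord_pred i) j)
    = dt / eps * dx i * dv j * (density (f n.+1) i * M j - f n.+1 i j).

End Mesh.

(* Main.v *)
(* Testing the scheme against f/M, in which the transport term is skew, gives
   an energy estimate: the solutions are bounded uniformly in eps, and their
   distance to the local equilibrium rho M, controlled by the dissipation of
   the collision operator, is O(eps).  The moments of order 0 and 1 in v then
   show that the densities solve the limit scheme up to a defect O(eps).  The
   implicit heat operator does not depend on eps and is invertible, so by
   induction on the time step the densities converge at rate O(eps).  The two
   collision operators enter only through conservation of mass, their action on
   the current, and a spectral gap, collected in [relaxation]. *)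

Require Import Defs.
From HB Require Import structures.
From mathcomp Require Import all_boot all_order all_algebra.
From mathcomp Require Import all_classical all_reals all_analysis.
From mathcomp Require Import ring lra zify.

Set Implicit Arguments.
Unset Strict Implicit.
Unset Printing Implicit Defensive.

Import Order.TTheory GRing.Theory Num.Theory.
Import numFieldNormedType.Exports.

Local Open Scope classical_set_scope.
Local Open Scope ring_scope.

(** * Bounds uniform over a parameter set *)

Section Dominated.
Variables (R : realType) (T : Type) (P : set T).
Implicit Types (w phi psi : T -> R).

(* A uniform bound over [P], unlike the Landau notations along a filter. *)
Definition dominated w phi := exists C, forall x, P x -> `|phi x| <= C * w x.

Lemma eq_dominated w phi psi :
  (forall x, P x -> phi x = psi x) -> dominated w phi -> dominated w psi.
Proof. by move=> e [C hC]; exists C => x Px; rewrite -e// hC. Qed.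

Lemma dominated0 w : dominated w (fun=> 0).
Proof. by exists 0 => x _; rewrite normr0 mul0r. Qed.

Lemma dominatedD w phi psi : dominated w phi -> dominated w psi ->
  dominated w (fun x => phi x + psi x).
Proof.
move=> [C hC] [D hD]; exists (C + D) => x Px.
by rewrite (le_trans (ler_normD _ _))// mulrDl lerD ?hC ?hD.
Qed.

Lemma dominatedN w phi : dominated w phi -> dominated w (fun x => - phi x).
Proof. by move=> [C hC]; exists C => x Px; rewrite normrN hC. Qed.

Lemma dominatedB w phi psi : dominated w phi -> dominated w psi ->
  dominated w (fun x => phi x - psi x).
Proof. by move=> h1 h2; exact: dominatedD h1 (dominatedN h2). Qed.

Lemma dominatedZ w phi (c : R) :
  dominated w phi -> dominated w (fun x => c * phi x).
Proof.
move=> [C hC]; exists (`|c| * C) => x Px.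
by rewrite normrM -mulrA ler_wpM2l ?hC.
Qed.

Lemma dominated_sum (I : finType) w (phi : I -> T -> R) :
  (forall i, dominated w (phi i)) -> dominated w (fun x => \sum_i phi i x).
Proof.
move=> h; apply: (eq_dominated (phi := \sum_i phi i)) => [x _|].
  by rewrite fct_sumE.
by elim/big_rec: _ => [|i psi _]; [exact: dominated0|exact: dominatedD].
Qed.

Lemma dominated_trans v w phi : (forall x, P x -> 0 <= v x) ->
  dominated v phi -> dominated w v -> dominated w phi.
Proof.
move=> v0 [C hC] [D hD]; exists (`|C| * D) => x Px.
apply: (le_trans (hC x Px)); rewrite -mulrA.
apply: (le_trans (y := `|C| * v x)); first by rewrite ler_wpM2r ?v0 ?ler_norm.
by rewrite ler_wpM2l// -[leLHS]ger0_norm ?v0 ?hD.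
Qed.

End Dominated.

(** * Summation by parts on the discrete torus *)

Section Periodic.
Variables (R : realType) (N : nat).
Implicit Types (F a b : 'I_N -> R).

Lemma sum_ordS F : \sum_i F (ordS i) = \sum_i F i.
Proof. by rewrite [RHS](reindex (@ordS N)) //; exact/onW_bij/ordS_bij. Qed.

Lemma sum_ord_pred F : \sum_i F (ord_pred i) = \sum_i F i.
Proof. by rewrite -sum_ordS; apply: eq_bigr => i _; rewrite ordSK. Qed.

Lemma periodic_by_parts a b :
  \sum_i a i * (b (ordS i) - b (ord_pred i)) =
  - \sum_i (a (ordS i) - a (ord_pred i)) * b i.
Proof.
under eq_bigr do rewrite mulrBr; under [in RHS]eq_bigr do rewrite mulrBl.
rewrite !sumrB opprB; congr (_ - _).
  rewrite -[LHS]sum_ord_pred.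
  by apply: eq_bigr => i _; rewrite ord_predK.
by rewrite -[LHS]sum_ordS; apply: eq_bigr => i _; rewrite ordSK.
Qed.

(** By parts with [b = a], the sum equals its own opposite. *)
Lemma periodic_skew a : \sum_i (a (ordS i) - a (ord_pred i)) * a i = 0.
Proof.
have := periodic_by_parts a a; under eq_bigr do rewrite mulrC.
by move=> h; lra.
Qed.

End Periodic.

(** * The implicit heat operator: coercivity and inverse *)

Section HeatOperator.
Variables (R : realType) (N : nat) (dx : 'I_N -> R) (dt m2 : R).
Hypotheses (dx0 : forall i, 0 < dx i) (dt0 : 0 <= dt) (m20 : 0 <= m2).
Implicit Types rho sigma : 'I_N -> R.

Definition heat_op rho (i : 'I_N) : R :=
  dx i * rho i
  - dt * (m2 / 2 * (Dx dx rho (ordS i) - Dx dx rho (ord_pred i))).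

Lemma DxE rho i : Dx dx rho i = (rho (ordS i) - rho (ord_pred i)) / (2 * dx i).
Proof.
by rewrite /Dx /rho_half ord_predK; have := lt0r_neq0 (dx0 i) => ?; field.
Qed.

(** Summation by parts turns the diffusion term into dt * m2 times the sum of dx_i (D_x rho)_i^2,
    which is nonnegative. *)
Lemma heat_op_coercive rho :
  \sum_i dx i * rho i ^+ 2 <= \sum_i rho i * heat_op rho i.
Proof.
have -> : \sum_i rho i * heat_op rho i = \sum_i dx i * rho i ^+ 2
   - dt * m2 / 2 * \sum_i rho i * (Dx dx rho (ordS i) - Dx dx rho (ord_pred i)).
  rewrite mulr_sumr -sumrB; apply: eq_bigr => i _.
  by rewrite /heat_op; field.
rewrite periodic_by_parts mulrN opprK lerDl mulr_ge0//.
  by rewrite !mulr_ge0 ?invr_ge0.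
apply: sumr_ge0 => i _; rewrite DxE mulrA -expr2.
by rewrite mulr_ge0 ?sqr_ge0// invr_ge0 mulr_ge0 ?ltW.
Qed.

Lemma heat_op_linear (c : R) rho sigma i :
  heat_op (fun k => c * rho k + sigma k) i =
  c * heat_op rho i + heat_op sigma i.
Proof.
have := lt0r_neq0 (dx0 (ordS i)); have := lt0r_neq0 (dx0 (ord_pred i)).
by rewrite /heat_op !DxE => ? ?; field; apply/andP.
Qed.

Lemma heat_op_eq0 rho :
  (forall i, heat_op rho i = 0) -> forall i, rho i = 0.
Proof.
move=> h i; have := heat_op_coercive rho.
rewrite [leRHS]big1 => [h0|k _]; last by rewrite h mulr0.
have t0 k : true -> 0 <= dx k * rho k ^+ 2 by rewrite mulr_ge0 ?sqr_ge0 ?ltW.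
have := le_anti (introT andP (conj h0 (sumr_ge0 (index_enum 'I_N) t0))).
move=> /psumr_eq0P => /(_ t0 i isT) /eqP.
by rewrite mulf_eq0 gt_eqF//= expf_eq0 /= => /eqP.
Qed.

(** In finite dimension a trivial kernel suffices for invertibility. The first identity solves one
    implicit step; the second recovers [rho] from [heat_op rho] and so transfers estimates on the
    defect to the density. *)
Lemma heat_op_inverse : exists B : 'M[R]_N,
  (forall sigma i, heat_op (fun k => \sum_l sigma l * B l k) i = sigma i) /\
  (forall rho i, rho i = \sum_l heat_op rho l * B l i).
Proof.
pose A (u : 'rV[R]_N) : 'rV[R]_N := \row_i heat_op (fun k => u 0 k) i.
have Alin : linear A.
  move=> c u v; apply/rowP => i; rewrite !mxE -heat_op_linear.
  by congr (heat_op _ i); apply/funext => k; rewrite !mxE.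
pose Al : {linear 'rV[R]_N -> 'rV[R]_N} :=
  HB.pack A (GRing.isLinear.Build _ _ _ _ A Alin).
have AE u : u *m lin1_mx Al = A u by rewrite mul_rV_lin1.
have unitA : lin1_mx Al \in unitmx.
  rewrite -row_free_unit -kermx_eq0; apply/rowV0P => u /sub_kermxP.
  rewrite AE => /rowP Au0; apply/rowP => k; rewrite mxE.
  by apply: (heat_op_eq0 (rho := fun k => u 0 k)) => i;
    have := Au0 i; rewrite !mxE.
exists (invmx (lin1_mx Al)); split=> [sigma|rho] i.
  have /rowP/(_ i) := mulmxKV unitA (\row_l sigma l).
  rewrite AE !mxE => <-; congr (heat_op _ i); apply/funext => k.
  by rewrite mxE; apply: eq_bigr => l _; rewrite mxE.
have /rowP/(_ i) := mulmxK unitA (\row_l rho l).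
rewrite AE !mxE => <-; apply: eq_bigr => l _; rewrite mxE.
congr (heat_op _ l * _).
by apply/funext => k; rewrite mxE.
Qed.

End HeatOperator.

(** * Energy estimate for an abstract collision operator *)

Section Relaxation.
Variables (R : realType) (L N : nat) (vh : 'I_L.*2.+1 -> R) (dx : 'I_N -> R).
Variables (dt : R) (M : 'I_L.*2 -> R).
Variable Q : 'M[R]_(N, L.*2) -> 'I_N -> 'I_L.*2 -> R.
Hypotheses (dx0 : forall i, 0 < dx i) (dt0 : 0 < dt).
Hypotheses (dv0 : forall j, 0 < dv vh j) (M0 : forall j, 0 < M j).
Implicit Types g : 'M[R]_(N, L.*2).

Definition current g (i : 'I_N) : R := \sum_j vmid vh j * dv vh j * g i j.

Definition dissipation g (i : 'I_N) : R := - \sum_j Q g i j * (g i j / M j).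

(** The operator damps the current at rate one, which makes [moment vh M 2] the diffusion
    coefficient of the limit. The gap is stated entry by entry; its constant may depend on the mesh,
    but not on [g]. *)
Record relaxation : Prop := Relaxation {
  relax_mass : forall g i, \sum_j Q g i j = 0;
  relax_current : forall g i,
    \sum_j vmid vh j * Q g i j = - (dx i * current g i);
  relax_ge0 : forall g i, 0 <= dissipation g i;
  relax_gap : forall i j,
    dominated setT (fun g => Num.sqrt (dissipation g i))
      (fun g => g i j - density vh g i * M j) }.

Definition kinetic_scheme (eps : R) (f : nat -> 'M[R]_(N, L.*2)) : Prop :=
  forall i j n,
    eps * dx i * dv vh j * (f n.+1 i j - f n i j)
      + dt * (xflux vh (f n.+1) i j - xflux vh (f n.+1) (ord_pred i) j)
    = dt / eps * Q (f n.+1) i j.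

Lemma xflux_diff g i j : xflux vh g i j - xflux vh g (ord_pred i) j =
  vmid vh j * dv vh j / 2 * (g (ordS i) j - g (ord_pred i) j).
Proof. by rewrite /xflux ord_predK; field. Qed.

Definition energy g : R := \sum_i \sum_j dx i * dv vh j / M j * g i j ^+ 2.

Lemma energy_weight_gt0 i j : 0 < dx i * dv vh j / M j.
Proof. by rewrite divr_gt0 ?mulr_gt0. Qed.

Lemma energy_ge0 g : 0 <= energy g.
Proof.
apply: sumr_ge0 => i _; apply: sumr_ge0 => j _.
by rewrite mulr_ge0 ?sqr_ge0// ltW ?energy_weight_gt0.
Qed.

(** At fixed velocity the weight does not depend on [i], so each sum over space vanishes by periodic
    skewness. *)
Lemma transport_skew g :
  \sum_i \sum_j
    (xflux vh g i j - xflux vh g (ord_pred i) j) * (g i j / M j) = 0.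
Proof.
rewrite exchange_big big1// => j _.
rewrite (eq_bigr (fun i => vmid vh j * dv vh j / 2 / M j
    * ((g (ordS i) j - g (ord_pred i) j) * g i j))) => [|i _].
  by rewrite -mulr_sumr (periodic_skew (fun i => g i j)) mulr0.
by rewrite xflux_diff; ring.
Qed.

(** Implicit Euler: the scheme is multiplied by 2 f^{n+1} / (eps M), and 2a(a - b) = a^2 - b^2 + (a
    - b)^2 is used. *)
Lemma energy_step eps f n : 0 < eps -> kinetic_scheme eps f ->
  energy (f n.+1) + 2 * dt / eps ^+ 2 * \sum_i dissipation (f n.+1) i
  <= energy (f n).
Proof.
move=> eps0 hf; have eps_neq0 := lt0r_neq0 eps0; set g := f n.+1.
pose T i j := xflux vh g i j - xflux vh g (ord_pred i) j.
(* A multiple of the vanishing transport sum is added, so that the inequality can be proved cell by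
   cell. *)
rewrite (_ : _ + _ = \sum_i \sum_j
    (dx i * dv vh j / M j * g i j ^+ 2
     - 2 * dt / eps ^+ 2 * (Q g i j * (g i j / M j))
     + 2 * dt / eps * (T i j * (g i j / M j)))); last first.
  have /(congr1 ( *%R (2 * dt / eps))) := transport_skew g.
  rewrite mulr0 => T0; rewrite -[LHS]addr0 -[X in _ + X]T0 /energy /dissipation.
  rewrite 2!mulr_sumr -!big_split; apply: eq_bigr => i _ /=.
  by rewrite mulrN !mulr_sumr -sumrN -!big_split.
apply: ler_sum => i _; apply: ler_sum => j _.
have M_neq0 := lt0r_neq0 (M0 j).
have dxdv : eps * dx i * dv vh j * (g i j - f n i j) + dt * T i j
            = dt / eps * Q g i j := hf i j n.
have -> : 2 * dt / eps ^+ 2 * (Q g i j * (g i j / M j)) =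
    2 / eps * (dt / eps * Q g i j) * (g i j / M j) by field; apply/andP.
rewrite -dxdv -subr_ge0.
(* What remains is exactly the numerical dissipation of the implicit time step. *)
rewrite (_ : _ - _ = dx i * dv vh j / M j * (f n i j - g i j) ^+ 2).
  by rewrite mulr_ge0 ?sqr_ge0// ltW ?energy_weight_gt0.
by field; apply/andP.
Qed.

(** The second velocity moment, whose differences in space drive the current. *)
Definition stress g (i : 'I_N) : R := \sum_j vmid vh j ^+ 2 * dv vh j * g i j.

(** * Uniform estimates and passage to the limit *)

Section Solution.
Variables (f0 : 'M[R]_(N, L.*2)) (f : R -> nat -> 'M[R]_(N, L.*2)).
Hypothesis hQ : relaxation.
Hypothesis hf0 : forall eps, 0 < eps -> f eps 0%N = f0.
Hypothesis hf : forall eps, 0 < eps -> kinetic_scheme eps (f eps).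
Local Notation pos := [set eps : R | 0 < eps].
Local Notation rho eps n := (density vh (f eps n)).
Local Notation m2 := (moment vh M 2).

Lemma energy_bound eps n : 0 < eps -> energy (f eps n) <= energy f0.
Proof.
move=> eps0; elim: n => [|n]; first by rewrite hf0.
apply: le_trans; apply: le_trans (energy_step n eps0 (hf eps0)).
rewrite lerDl mulr_ge0//; first by rewrite divr_ge0 ?sqr_ge0 ?mulr_ge0 ?ltW.
by apply: sumr_ge0 => i _; exact: relax_ge0.
Qed.

(** The energy is a sum of nonnegative terms, one of which is [w] times the square of this entry. *)
Lemma solution_bounded n i j : dominated pos (cst 1) (fun eps => f eps n i j).
Proof.
pose w := dx i * dv vh j / M j; have w0 : 0 < w by exact: energy_weight_gt0.
exists (Num.sqrt (energy f0 / w)) => eps eps0; rewrite mulr1 -sqrtr_sqr.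
apply: ler_wsqrtr; rewrite ler_pdivlMr// mulrC.
apply: le_trans (energy_bound n eps0).
have t0 k l : 0 <= dx k * dv vh l / M l * f eps n k l ^+ 2.
  by rewrite mulr_ge0 ?sqr_ge0// ltW ?energy_weight_gt0.
rewrite /energy (bigD1 i)//= (bigD1 j)//= -addrA lerDl addr_ge0 ?sumr_ge0//.
by move=> k _; rewrite sumr_ge0.
Qed.

(** The energy estimate controls the dissipation only after a step, since the initial data may be
    far from equilibrium; hence the index [n.+1]. *)
Lemma solution_gap n i j :
  dominated pos id (fun eps => f eps n.+1 i j - rho eps n.+1 i * M j).
Proof.
have [C hC] := relax_gap hQ i j.
apply: (dominated_trans
    (v := fun eps => Num.sqrt (dissipation (f eps n.+1) i))).
- by move=> *; exact: sqrtr_ge0.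
- by exists C => eps _; exact: hC.
(* By [energy_step], 2 dt / eps^2 times the dissipation is at most [energy f0]; the constant comes
   from taking square roots. *)
exists (Num.sqrt (energy f0 / (2 * dt))) => eps eps0.
rewrite ger0_norm ?sqrtr_ge0// mulrC.
have E0 := energy_ge0 f0.
rewrite -[X in X * _](gtr0_norm eps0) -sqrtr_sqr -sqrtrM ?sqr_ge0//.
apply: ler_wsqrtr; rewrite mulrA ler_pdivlMr ?mulr_gt0//.
rewrite mulrC -ler_pdivrMl ?exprn_gt0//.
apply: le_trans (energy_bound n eps0).
apply: le_trans (energy_step n eps0 (hf eps0)).
rewrite mulrA [_^-1 * _]mulrC -[leLHS]add0r lerD//.
  exact: energy_ge0.
rewrite ler_wpM2l//; first by rewrite divr_ge0 ?sqr_ge0 ?mulr_ge0 ?ltW.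
rewrite (bigD1 i)//= lerDl sumr_ge0// => k _; exact: relax_ge0.
Qed.

(** The moment of order 0 of the scheme, divided by eps: collisions conserve mass and drop out. *)
Lemma mass_balance eps n i : 0 < eps ->
  dx i * (rho eps n.+1 i - rho eps n i) =
  - (dt / 2) * (current (f eps n.+1) (ordS i) / eps
                - current (f eps n.+1) (ord_pred i) / eps).
Proof.
move=> eps0; have eps_neq0 := lt0r_neq0 eps0.
have : \sum_j (eps * dx i * dv vh j * (f eps n.+1 i j - f eps n i j)
    + dt * (xflux vh (f eps n.+1) i j - xflux vh (f eps n.+1) (ord_pred i) j))
   = \sum_j dt / eps * Q (f eps n.+1) i j.
  by apply: eq_bigr => j _; exact: hf.
rewrite -[in RHS]mulr_sumr relax_mass// mulr0.
rewrite (_ : \sum_j _ = eps * dx i * (rho eps n.+1 i - rho eps n i)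
   + dt / 2 * (current (f eps n.+1) (ordS i)
               - current (f eps n.+1) (ord_pred i))); last first.
  rewrite /density /current -!sumrB !mulr_sumr -big_split/=.
  by apply: eq_bigr => j _; rewrite xflux_diff; ring.
move=> h; apply: (mulfI eps_neq0).
transitivity (- (dt / 2 * (current (f eps n.+1) (ordS i)
               - current (f eps n.+1) (ord_pred i)))); first by lra.
by field.
Qed.

(** The moment of order 1 of the scheme, solved for the rescaled current that the collision term
    produces. *)
Lemma current_balance eps n i : 0 < eps ->
  current (f eps n.+1) i / eps =
  - (eps / dt * (current (f eps n.+1) i - current (f eps n) i)
     + (stress (f eps n.+1) (ordS i) - stress (f eps n.+1) (ord_pred i))
       / (2 * dx i)).
Proof.
move=> eps0; have eps_neq0 := lt0r_neq0 eps0.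
have : \sum_j vmid vh j * (eps * dx i * dv vh j * (f eps n.+1 i j - f eps n i j)
    + dt * (xflux vh (f eps n.+1) i j - xflux vh (f eps n.+1) (ord_pred i) j))
   = \sum_j dt / eps * (vmid vh j * Q (f eps n.+1) i j).
  by apply: eq_bigr => j _; rewrite hf// mulrCA.
rewrite -[in RHS]mulr_sumr relax_current//.
rewrite (_ : \sum_j _ =
   eps * dx i * (current (f eps n.+1) i - current (f eps n) i)
   + dt / 2 * (stress (f eps n.+1) (ordS i)
               - stress (f eps n.+1) (ord_pred i))); last first.
  rewrite /stress /current -!sumrB !mulr_sumr -big_split/=.
  by apply: eq_bigr => j _; rewrite xflux_diff; ring.
have dt_neq0 := lt0r_neq0 dt0; have dx_neq0 := lt0r_neq0 (dx0 i).
move=> h; apply: (mulfI (mulf_neq0 dt_neq0 dx_neq0)).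
transitivity (- (dt / eps * - (dx i * current (f eps n.+1) i))).
  by field.
by rewrite -h; field; apply/andP.
Qed.

(* Fick's law: the rescaled current J/eps tends to - m2 D_x rho. *)
Lemma fick_law n i : dominated pos id (fun eps =>
  current (f eps n.+1) i / eps + m2 * Dx dx (rho eps n.+1) i).
Proof.
(* The stress of the local equilibrium is m2 rho; [k] is the remainder, of order eps by the gap. *)
pose k eps l := \sum_j vmid vh j ^+ 2 * dv vh j
  * (f eps n.+1 l j - rho eps n.+1 l * M j).
have kO l : dominated pos id (k ^~ l).
  by apply: dominated_sum => j; apply/dominatedZ/solution_gap.
(* Boundedness of the current suffices here, and it also holds at the initial time [m = 0]. *)
have JO m : dominated pos id (fun eps => eps * current (f eps m) i).
  have [C hC] : dominated pos (cst 1) (fun eps => current (f eps m) i).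
    by apply: dominated_sum => j; apply/dominatedZ/solution_bounded.
  exists C => eps eps0; rewrite normrM (gtr0_norm eps0) /= mulrC.
  by rewrite ler_wpM2r ?(ltW eps0)//; have := hC eps eps0; rewrite mulr1.
have stressE eps l : stress (f eps n.+1) l = m2 * rho eps n.+1 l + k eps l.
  rewrite /stress /k /moment mulr_suml -big_split; apply: eq_bigr => j _ /=.
  by rewrite real_normK ?num_real//; ring.
apply: (eq_dominated (phi := fun eps =>
   - (dt^-1 * (eps * current (f eps n.+1) i - eps * current (f eps n) i)
      + (2 * dx i)^-1 * (k eps (ordS i) - k eps (ord_pred i))))).
  move=> eps eps0; rewrite current_balance// !stressE DxE//.
  by have := lt0r_neq0 dt0; have := lt0r_neq0 (dx0 i) => ? ?; field; apply/andP.
by apply/dominatedN/dominatedD; apply/dominatedZ/dominatedB.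
Qed.

(** Inserting Fick's law into the mass balance leaves only differences of its error [s]. *)
Lemma heat_defect n i : dominated pos id (fun eps =>
  heat_op dx dt m2 (rho eps n.+1) i - dx i * rho eps n i).
Proof.
pose s eps l := current (f eps n.+1) l / eps + m2 * Dx dx (rho eps n.+1) l.
apply: (eq_dominated (phi := fun eps =>
    - (dt / 2) * (s eps (ordS i) - s eps (ord_pred i)))).
  move=> eps eps0.
  have -> : heat_op dx dt m2 (rho eps n.+1) i - dx i * rho eps n i =
      dx i * (rho eps n.+1 i - rho eps n i)
      - dt * (m2 / 2 * (Dx dx (rho eps n.+1) (ordS i)
                        - Dx dx (rho eps n.+1) (ord_pred i))).
    by rewrite /heat_op; ring.
  by rewrite mass_balance// /s; field; exact: lt0r_neq0.
by apply/dominatedZ/dominatedB; exact: fick_law.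
Qed.

Lemma relaxation_limit : exists r : nat -> 'I_N -> R,
  [/\ forall n i, heat_op dx dt m2 (r n.+1) i = dx i * r n i,
      forall i, r 0%N i = density vh f0 i
    & forall n i j,
        dominated pos id (fun eps => f eps n.+1 i j - r n.+1 i * M j)].
Proof.
have m20 : 0 <= m2.
  apply: sumr_ge0 => j _; rewrite mulr_ge0 ?(ltW (dv0 j))//.
  by rewrite mulr_ge0 ?(ltW (M0 j))// exprn_ge0.
have [B [BK KB]] := heat_op_inverse dx0 (ltW dt0) m20.
(* The limit densities are built by solving the implicit heat scheme with the inverse [B]. *)
pose r := fix r n : 'I_N -> R := if n is n'.+1
  then fun i => \sum_l (dx l * r n' l) * B l i else density vh f0.
have rO n i : dominated pos id (fun eps => rho eps n i - r n i).
  elim: n i => [|n IH] i /=.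
    apply: (eq_dominated (phi := fun=> 0)); last exact: dominated0.
    by move=> eps eps0; rewrite hf0// subrr.
  (* The new error is [B] applied to the defect of the step plus the error carried over from step
     [n]. *)
  apply: (eq_dominated (phi := fun eps => \sum_l B l i
     * (heat_op dx dt m2 (rho eps n.+1) l - dx l * rho eps n l
        + dx l * (rho eps n l - r n l)))).
    move=> eps _; rewrite [in RHS](KB (rho eps n.+1) i) -sumrB.
    by apply: eq_bigr => l _; ring.
  apply: dominated_sum => l; apply: dominatedZ.
  by apply: dominatedD; [exact: heat_defect|exact/dominatedZ/IH].
exists r; split=> [n i|//|n i j]; first exact: BK.
(* Distance to the local equilibrium plus the error on the density. *)
apply: (eq_dominated (phi := fun eps =>
  f eps n.+1 i j - rho eps n.+1 i * M j + M j * (rho eps n.+1 i - r n.+1 i))).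
  by move=> eps _; ring.
by apply: dominatedD; [exact: solution_gap|exact/dominatedZ/rO].
Qed.

End Solution.
End Relaxation.

(** * Sums of squares and discrete calculus in velocity *)

Lemma dominated_sqrt_sum (R : realType) (T : Type) (P : set T) (I : finType)
    (c : I -> R) (phi : I -> T -> R) (D : T -> R) (k : I) :
  (forall i, 0 <= c i) -> 0 < c k ->
  (forall x, P x -> D x = \sum_i c i * phi i x ^+ 2) ->
  dominated P (fun x => Num.sqrt (D x)) (phi k).
Proof.
move=> c0 ck DE; exists (Num.sqrt (c k)^-1) => x Px.
rewrite -sqrtr_sqr -sqrtrM ?invr_ge0 ?(ltW ck)//; apply: ler_wsqrtr.
rewrite mulrC ler_pdivlMr// mulrC DE// (bigD1 k)//= lerDl sumr_ge0// => i _.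
by rewrite mulr_ge0 ?sqr_ge0.
Qed.

Section Interfaces.
Variables (R : realType) (L : nat).
Implicit Types (a : 'I_L.*2 -> R) (G : 'I_L.*2.+1 -> R) (k : 'I_L.*2.+1).

(** At the two extreme interfaces, which lack a neighbouring cell, the jump takes the default value
    0. *)
Definition jump a k : R :=
  if cellL k is Some jl then if cellR k is Some jr then a jr - a jl else 0
  else 0.

Lemma cellLE k jl : cellL k = Some jl -> k = edgeR jl.
Proof. by rewrite /cellL; case: unliftP => // j -> [->]. Qed.

Lemma cellRE k jr : cellR k = Some jr -> k = edgeL jr.
Proof.
rewrite /cellR; case: unliftP => // j -> [->].
by apply/val_inj; rewrite [LHS]lift_max.
Qed.

Lemma cellL_None k : cellL k = None -> k = ord0.
Proof. by rewrite /cellL; case: unliftP. Qed.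

Lemma cellR_None k : cellR k = None -> k = ord_max.
Proof. by rewrite /cellR; case: unliftP. Qed.

Lemma interface_by_parts a G : G ord0 = 0 -> G ord_max = 0 ->
  \sum_j a j * (G (edgeR j) - G (edgeL j)) = - \sum_k G k * jump a k.
Proof.
move=> G0 G1; under eq_bigr do rewrite mulrBr; rewrite sumrB.
(* Both sums are carried over to all interfaces; [G] vanishes exactly where the default 0 stands for
   a missing cell. *)
pose FL k := G k * oapp a 0 (cellL k); pose FR k := G k * oapp a 0 (cellR k).
have -> : \sum_j a j * G (edgeR j) = \sum_k FL k.
  rewrite big_ord_recl [FL ord0]/FL G0 mul0r add0r; apply: eq_bigr => j _.
  by rewrite /FL cellL_edgeR mulrC.
have -> : \sum_j a j * G (edgeL j) = \sum_k FR k.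
  rewrite big_ord_recr /= [FR ord_max]/FR G1 mul0r addr0; apply: eq_bigr => j _.
  by rewrite /FR cellR_edgeL mulrC.
rewrite -sumrB -sumrN; apply: eq_bigr => k _; rewrite /FL /FR /jump.
case EL: (cellL k) => [jl|]; last by rewrite (cellL_None EL) G0; ring.
case ER: (cellR k) => [jr|]; last by rewrite (cellR_None ER) G1; ring.
by rewrite /=; ring.
Qed.

(* Discrete Poincare inequality: every increment is a sum of jumps. *)
Lemma dominated_increment (T : Type) (P : set T) (w : T -> R)
    (u : T -> 'I_L.*2 -> R) :
  (forall k, dominated P w (fun x => jump (u x) k)) ->
  forall j l, dominated P w (fun x => u x j - u x l).
Proof.
move=> h.
have hS (j j' : 'I_L.*2) : j' = j.+1 :> nat ->
    dominated P w (fun x => u x j' - u x j).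
  move=> jj'; have eLR : edgeL j' = edgeR j by apply/val_inj; rewrite /= jj'.
  apply: eq_dominated (h (edgeL j')) => x _; rewrite /jump cellR_edgeL.
  by rewrite eLR cellL_edgeR.
(* Increments from the first cell, by induction on the cell; a general increment is a difference of
   two of these. *)
have h0 (j : 'I_L.*2) (lt0 : (0 < L.*2)%N) :
    dominated P w (fun x => u x j - u x (Ordinal lt0)).
  case: j => m; elim: m => [|m IH] hm.
    apply: (eq_dominated (phi := fun=> 0)); last exact: dominated0.
    by move=> x _; rewrite (bool_irrelevance hm lt0) subrr.
  apply: eq_dominated (dominatedD (hS (Ordinal (ltnW hm)) (Ordinal hm) erefl)
    (IH (ltnW hm))) => x _; ring.
move=> j l; have lt0 : (0 < L.*2)%N by exact: leq_ltn_trans (ltn_ord j).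
by apply: eq_dominated (dominatedB (h0 j lt0) (h0 l lt0)) => x _; ring.
Qed.

End Interfaces.

(** * Positivity and symmetry of the velocity mesh *)

Section VelocityMesh.
Variables (R : realType) (L : nat) (vstar : R) (vh : 'I_L.*2.+1 -> R).
Hypothesis hvh : velocity_mesh vstar vh.

Lemma dv_gt0 j : 0 < dv vh j.
Proof. by rewrite subr_gt0 (vmesh_incr hvh)// lift0. Qed.

Lemma vh_rev k : vh (rev_ord k) = - vh k.
Proof.
case: (leqP L k) => hk; first by rewrite (vmesh_sym hvh hk) opprK.
by rewrite (vmesh_sym hvh (k := rev_ord k)) ?rev_ordK//=; lia.
Qed.

Lemma edgeL_rev (j : 'I_L.*2) : edgeL (rev_ord j) = rev_ord (edgeR j).
Proof. by apply/val_inj; rewrite /= /bump leq0n add1n subSS. Qed.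

Lemma edgeR_rev (j : 'I_L.*2) : edgeR (rev_ord j) = rev_ord (edgeL j).
Proof. by rewrite -[RHS]rev_ordK -[j in RHS]rev_ordK edgeL_rev !rev_ordK. Qed.

Lemma vmid_rev j : vmid vh (rev_ord j) = - vmid vh j.
Proof. by rewrite /vmid edgeL_rev edgeR_rev !vh_rev; field. Qed.

Lemma dv_rev j : dv vh (rev_ord j) = dv vh j.
Proof. by rewrite /dv edgeL_rev edgeR_rev !vh_rev; ring. Qed.

Lemma rev_ord_half (j : 'I_L.*2) : (j < L)%N -> (L <= rev_ord j)%N.
Proof. by rewrite /=; lia. Qed.

(** Cells from index [L] on lie in the positive half-line; the left edge of cell [L] is the
    interface at 0. *)
Lemma vmid_gt0 (j : 'I_L.*2) : (L <= j)%N -> 0 < vmid vh j.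
Proof.
move=> Lj; have hR : 0 < vh (edgeR j).
  rewrite -(vmesh_mid hvh) (vmesh_incr hvh)// inordK ?lift0//; lia.
have hL : 0 <= vh (edgeL j).
  rewrite -(vmesh_mid hvh); move: Lj; rewrite leq_eqVlt => /predU1P[Lj|Lj].
    rewrite (_ : edgeL j = inord L)//; apply/val_inj => /=.
    by rewrite inordK -?Lj//; lia.
  by rewrite ltW// (vmesh_incr hvh)// inordK//; lia.
by rewrite divr_gt0// ltr_wpDl.
Qed.

Lemma vmid_neq0 j : vmid vh j != 0.
Proof.
case: (leqP L j) => jL; first by rewrite gt_eqF ?vmid_gt0.
by rewrite -oppr_eq0 -vmid_rev gt_eqF ?vmid_gt0 ?rev_ord_half.
Qed.

Lemma dvh_gt0 k jl jr : cellL k = Some jl -> cellR k = Some jr ->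
  0 < dvh vstar vh k.
Proof.
(* The two cells share the interface [k], so [dvh] is half the distance between their outer
   edges. *)
move=> eL eR; rewrite /dvh eL eR /= /vmid -(cellLE eL) -(cellRE eR).
have h1 : vh (edgeL jl) < vh k.
  by rewrite (vmesh_incr hvh)// (cellLE eL) lift0.
have h2 : vh k < vh (edgeR jr).
  by rewrite (vmesh_incr hvh)// (cellRE eR) lift0.
lra.
Qed.

(** * The BGK operator *)

Section Schemes.
Variables (N : nat) (dx : 'I_N -> R) (m2min m2max m4max : R).
Variable M : 'I_L.*2 -> R.
Hypothesis dx0 : forall i, 0 < dx i.

Definition BGK_op (g : 'M[R]_(N, L.*2)) (i : 'I_N) (j : 'I_L.*2) : R :=
  dx i * dv vh j * (density vh g i * M j - g i j).

Lemma BGK_relaxation :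
  maxwellian_BGK vh m2min m2max m4max M -> relaxation vh dx M BGK_op.
Proof.
case=> M0 Msym mass _ _.
have Mrev j : M (rev_ord j) = M j.
  case: (leqP L j) => jL; first by rewrite -Msym.
  by rewrite Msym ?rev_ordK ?rev_ord_half.
(* The Maxwellian is even and the velocities are odd, so the equilibrium carries no current. *)
have M_odd : \sum_j vmid vh j * dv vh j * M j = 0.
  suff : \sum_j vmid vh j * dv vh j * M j = - \sum_j vmid vh j * dv vh j * M j.
    by move=> h; lra.
  rewrite {1}(reindex_inj rev_ord_inj) -sumrN; apply: eq_bigr => j _ /=.
  by rewrite vmid_rev dv_rev Mrev; ring.
have Q_mass g i : \sum_j BGK_op g i j = 0.
  transitivity (dx i * (density vh g i * (\sum_j M j * dv vh j)
                        - density vh g i)); last by rewrite mass; ring.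
  rewrite mulr_sumr [X in _ - X]/density -sumrB mulr_sumr.
  by apply: eq_bigr => j _; rewrite /BGK_op; ring.
(* Adding the density times the vanishing mass of [BGK_op] completes the square, which gives the gap
   directly. *)
have dissE g i : dissipation M BGK_op g i =
    \sum_j dx i * dv vh j / M j * (g i j - density vh g i * M j) ^+ 2.
  rewrite /dissipation -[LHS]addr0 -[X in _ + X](mulr0 (density vh g i)).
  rewrite -[X in _ * X](Q_mass g i) mulr_sumr -sumrN -big_split.
  apply: eq_bigr => j _ /=; rewrite /BGK_op.
  by have := lt0r_neq0 (M0 j) => ?; field.
have c0 i j : 0 < dx i * dv vh j / M j.
  by rewrite energy_weight_gt0//; exact: dv_gt0.
split=> [//|g i|g i|i j].
- transitivity (dx i * (density vh g i * (\sum_j vmid vh j * dv vh j * M j)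
                        - current vh g i)); last by rewrite M_odd; ring.
  rewrite /current mulr_sumr -sumrB mulr_sumr.
  by apply: eq_bigr => j _; rewrite /BGK_op; ring.
- by rewrite dissE sumr_ge0// => j _; rewrite mulr_ge0 ?sqr_ge0 ?ltW.
- apply: (@dominated_sqrt_sum R 'M[R]_(N, L.*2) setT _
    (fun j => dx i * dv vh j / M j)
    (fun j g => g i j - density vh g i * M j)
    (fun g => dissipation M BGK_op g i) j) => // l.
  exact: ltW.
Qed.

(** * The Fokker-Planck operator *)

Variable Mstar : 'I_L.*2.+1 -> R.
Hypothesis hM : maxwellian_FP vh m2min m2max m4max Mstar M.

Lemma Mstar_diff j :
  Mstar (edgeL j) - Mstar (edgeR j) = M j * vmid vh j * dv vh j.
Proof.
rewrite (fp_def hM) -mulrA divfK// mulf_neq0 ?vmid_neq0//.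
by rewrite gt_eqF ?dv_gt0.
Qed.

(** [Mstar] decreases strictly to 0 on the half where velocities are positive; the induction is on
    the distance [d] to the last interface. *)
Lemma Mstar_gt0_right (k : 'I_L.*2.+1) : (L <= k < L.*2)%N -> 0 < Mstar k.
Proof.
move: {-1}(L.*2 - k)%N (erefl (L.*2 - k)%N) => d.
elim: d k => [|d IH] k dE /andP[Lk kL].
  by move: kL; rewrite -subn_gt0 dE.
have kE : k = edgeL (Ordinal kL) by apply/val_inj.
have eR : edgeR (Ordinal kL) = k.+1 :> nat by exact: lift0.
have : 0 <= Mstar (edgeR (Ordinal kL)).
  case: (ltngtP (edgeR (Ordinal kL)) L.*2) => [lt|gt|eq].
  - by rewrite ltW// IH//; lia.
  - by have := ltn_ord (edgeR (Ordinal kL)); lia.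
  - by rewrite (_ : edgeR _ = ord_max) ?(fp_last hM)//; exact/val_inj.
rewrite {2}kE -subr_gt0 subr0 => h.
have := Mstar_diff (Ordinal kL).
have : 0 < M (Ordinal kL) * vmid vh (Ordinal kL) * dv vh (Ordinal kL).
  by apply: mulr_gt0 (dv_gt0 _); apply: mulr_gt0 (fp_gt0 hM _) (vmid_gt0 _).
by lra.
Qed.

Lemma Mstar_gt0 k jl jr : cellL k = Some jl -> cellR k = Some jr -> 0 < Mstar k.
Proof.
move=> /cellLE kL /cellRE kR.
have k0 : (0 < k)%N by rewrite kL lift0.
have k2L : (k < L.*2)%N by rewrite kR; exact: (ltn_ord jr).
case: (leqP L k) => Lk; first by rewrite Mstar_gt0_right ?Lk.
rewrite (fp_sym hM) Mstar_gt0_right//=; lia.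
Qed.

Definition FP_op (g : 'M[R]_(N, L.*2)) (i : 'I_N) (j : 'I_L.*2) : R :=
  vflux vstar vh dx Mstar M g i (edgeR j)
  - vflux vstar vh dx Mstar M g i (edgeL j).

Let c i k := Mstar k * (dx i / dvh vstar vh k).

Lemma vfluxE g i k : vflux vstar vh dx Mstar M g i k =
  c i k * jump (fun j => g i j / M j) k.
Proof.
rewrite /vflux /jump /c; case: (cellL k) => [jl|]; last by rewrite mulr0.
by case: (cellR k) => [jr|]; [ring|rewrite mulr0].
Qed.

Lemma vflux_first g i : vflux vstar vh dx Mstar M g i ord0 = 0.
Proof. by rewrite vfluxE /c (fp_first hM) !mul0r. Qed.

Lemma vflux_last g i : vflux vstar vh dx Mstar M g i ord_max = 0.
Proof. by rewrite vfluxE /c (fp_last hM) !mul0r. Qed.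

(** Weak form of the operator: [a = 1], [a = vmid vh] and [a = g / M] yield mass, current and
    dissipation. *)
Lemma FP_op_by_parts g i (a : 'I_L.*2 -> R) : \sum_j a j * FP_op g i j =
  - \sum_k c i k * jump (fun j => g i j / M j) k * jump a k.
Proof.
rewrite interface_by_parts ?vflux_first ?vflux_last//.
by under eq_bigr do rewrite vfluxE.
Qed.

Lemma FP_relaxation : relaxation vh dx M FP_op.
Proof.
have M0 := fp_gt0 hM; have mass := fp_mass hM.
have dissE g i : dissipation M FP_op g i =
    \sum_k c i k * jump (fun j => g i j / M j) k ^+ 2.
  rewrite /dissipation; under eq_bigr do rewrite mulrC.
  by rewrite FP_op_by_parts opprK; apply: eq_bigr => k _; rewrite -mulrA -expr2.
have c0 i k : 0 <= c i k.
  case EL: (cellL k) => [jl|]; last first.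
    by rewrite (cellL_None EL) /c (fp_first hM) mul0r.
  case ER: (cellR k) => [jr|]; last first.
    by rewrite (cellR_None ER) /c (fp_last hM) mul0r.
  by rewrite ltW// mulr_gt0 ?divr_gt0 ?(Mstar_gt0 EL ER) ?(dvh_gt0 EL ER).
split=> [g i|g i|g i|i j].
- rewrite (eq_bigr (fun j => 1 * FP_op g i j)) => [|j _]; last by rewrite mul1r.
  rewrite FP_op_by_parts big1 ?oppr0// => k _.
  rewrite [X in _ * X](_ : _ = 0) ?mulr0//.
  by rewrite /jump; case: cellL => // ?; case: cellR => // ?; rewrite subrr.
- rewrite FP_op_by_parts; congr (- _).
  (* The jump of the velocity is [dvh], which cancels the denominator of the flux. A second
     summation by parts then moves the difference onto [Mstar], where it equals M v dv. *)
  transitivity (dx i * \sum_k Mstar k * jump (fun j => g i j / M j) k).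
    rewrite mulr_sumr; apply: eq_bigr => k _.
    rewrite /jump /c; case EL: (cellL k) => [jl|]; last by rewrite !mulr0.
    case ER: (cellR k) => [jr|]; last by rewrite !mulr0.
    have -> : vmid vh jr - vmid vh jl = dvh vstar vh k by rewrite /dvh EL ER.
    have := lt0r_neq0 (dvh_gt0 EL ER); have := lt0r_neq0 (M0 jl).
    by have := lt0r_neq0 (M0 jr) => ? ? ?; field; apply/and3P.
  congr (_ * _); rewrite -[LHS]opprK.
  rewrite -interface_by_parts ?(fp_first hM) ?(fp_last hM)//.
  rewrite -sumrN; apply: eq_bigr => j _; rewrite -mulrN opprB Mstar_diff.
  by have := lt0r_neq0 (M0 j) => ?; field.
- by rewrite dissE sumr_ge0// => k _; rewrite mulr_ge0 ?sqr_ge0.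
have jumpO k : dominated setT (fun g => Num.sqrt (dissipation M FP_op g i))
    (fun g => jump (fun j => g i j / M j) k).
  case EL: (cellL k) => [jl|]; last first.
    apply: eq_dominated (dominated0 _ _) => g _; by rewrite /jump EL.
  case ER: (cellR k) => [jr|]; last first.
    apply: eq_dominated (dominated0 _ _) => g _; by rewrite /jump EL ER.
  apply: (@dominated_sqrt_sum R 'M[R]_(N, L.*2) setT _ (c i)
    (fun k g => jump (fun j => g i j / M j) k)
    (fun g => dissipation M FP_op g i) k) => //.
  by rewrite mulr_gt0 ?divr_gt0 ?(Mstar_gt0 EL ER) ?(dvh_gt0 EL ER).
(* As M dv has total mass 1, g/M minus the density is an average of increments of g/M, each
   controlled by the jumps. *)
apply: (eq_dominated (phi := fun g : 'M[R]_(N, L.*2) =>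
   M j * \sum_l M l * dv vh l * (g i j / M j - g i l / M l))).
  move=> g _; transitivity (M j * ((\sum_l M l * dv vh l) * (g i j / M j)
                                   - density vh g i)).
    congr (_ * _); rewrite mulr_suml /density -sumrB; apply: eq_bigr => l _.
    have := lt0r_neq0 (M0 l); have := lt0r_neq0 (M0 j) => ? ?.
    by field; apply/andP.
  by rewrite mass; have := lt0r_neq0 (M0 j) => ?; field.
apply/dominatedZ/dominated_sum => l; apply/dominatedZ.
exact: (dominated_increment (u := fun (g : 'M[R]_(N, L.*2)) j => g i j / M j)).
Qed.

End Schemes.
End VelocityMesh.

(** * Convergence of the schemes *)

Lemma dominated_cvg_mx (R : realType) (m n : nat) (f : R -> 'M[R]_(m, n))
    (l : 'M[R]_(m, n)) :
  (forall i j,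
    dominated [set eps | 0 < eps] id (fun eps => f eps i j - l i j)) ->
  f eps @[eps --> 0^'+] --> l.
Proof.
move=> h; apply/cvg_ballP => e e0.
(* Adding 1 to the absolute value of [C] makes it a positive divisor; finitely many entries then
   share one neighbourhood. *)
have near_ij i j : \forall eps \near (0 : R)^'+, ball (l i j) e (f eps i j).
  have [C hC] := h i j.
  have C0 : 0 < `|C| + 1 by rewrite ltr_wpDl.
  near=> eps; have eps0 : 0 < eps by near: eps; exact: nbhs_right_gt.
  rewrite /ball /= distrC (le_lt_trans (hC eps eps0))//.
  apply: (@le_lt_trans _ _ ((`|C| + 1) * eps)).
    by rewrite ler_wpM2r ?(ltW eps0)// (le_trans (ler_norm C))// lerDl.
  rewrite mulrC -ltr_pdivlMr//.
  by near: eps; apply: nbhs_right_lt; rewrite divr_gt0.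
have : \forall eps \near (0 : R)^'+, forall i j, ball (l i j) e (f eps i j).
  by apply: filter_forall => i; exact: filter_forall.
by apply: filterS => eps heps; split.
Unshelve. all: by end_near. Qed.

Theorem theorem1 (R : realType) (L N : nat) (hL : (1 <= L)%N) (hN : (1 <= N)%N)
  (vstar : R) (hvstar : 0 < vstar)
  (vh : 'I_L.*2.+1 -> R) (hvh : velocity_mesh vstar vh)
  (dx : 'I_N -> R) (hdx : space_mesh dx)
  (m2min m2max m4max : R) (hm2min : 0 < m2min) (hm2max : m2min <= m2max)
  (dt : R) (hdt : 0 < dt)
  (M : 'I_L.*2 -> R)
  (f0 : 'M[R]_(N, L.*2)) (f : R -> nat -> 'M[R]_(N, L.*2))
  (hf0 : forall eps : R, 0 < eps -> f eps 0%N = f0)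
  (hf : (exists2 Mstar : 'I_L.*2.+1 -> R,
           maxwellian_FP vh m2min m2max m4max Mstar M
           & forall eps : R, 0 < eps ->
               FP_scheme vstar vh dx Mstar M dt eps (f eps))
        \/ (maxwellian_BGK vh m2min m2max m4max M
            /\ forall eps : R, 0 < eps ->
                 BGK_scheme vh dx M dt eps (f eps))) :
  exists rho : nat -> 'I_N -> R,
    [/\ forall n : nat, (1 <= n)%N ->
          f eps n @[eps --> 0^'+] --> \matrix_(i, j) (rho n i * M j),
        forall (i : 'I_N) (n : nat),
          dx i * ((rho n.+1 i - rho n i) / dt)
          = moment vh M 2 / 2
            * (Dx dx (rho n.+1) (ordS i) - Dx dx (rho n.+1) (ord_pred i))
      & forall i : 'I_N, rho 0%N i = density vh f0 i].
Proof.
have [dx0 _] := hdx; have dv0 := dv_gt0 hvh.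
(* Both schemes are cast as one kinetic scheme whose operator satisfies [relaxation]. *)
have [M0 [Q [hQ hs]]] : (forall j, 0 < M j) /\ exists Q,
    relaxation vh dx M Q
    /\ forall eps, 0 < eps -> kinetic_scheme vh dx dt Q eps (f eps).
  case: hf => [[Mstar hM hs]|[hM hs]]; split.
  - exact: fp_gt0 hM.
  - exists (FP_op vstar vh dx M Mstar); split=> //.
    exact: (FP_relaxation hvh dx0 hM).
  - exact: bgk_gt0 hM.
  - exists (BGK_op vh dx M); split; first exact: (BGK_relaxation hvh dx0 hM).
    by move=> eps eps0 i j n; rewrite (hs eps eps0) /BGK_op !mulrA.
have [r [heat r0 rO]] := relaxation_limit dx0 hdt dv0 M0 hQ hf0 hs.
exists r; split=> // [[//|n] _|i n].
  by apply: dominated_cvg_mx => i j; rewrite mxE; exact: rO.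
(* Multiplying by [dt] turns the heat scheme into the equation for [heat_op]. *)
have := heat n i; rewrite /heat_op => h; apply: (mulfI (lt0r_neq0 hdt)).
transitivity (dx i * r n.+1 i - dx i * r n i); last by rewrite -h; ring.
by field; exact: lt0r_neq0.
Qed.
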